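(* There is a positive constant $\gamma$ such that for every integer $t \geq 30$ and every integer $m \leq \gamma 2^t$, every $(m,m,m,m)$-cube $A$ of order $n=2^t$ is avoidable.
   Context: A cube of order $n$ is an $n\times n\times n$ array of cells $(i,j,k)$, $i,j,k\in[n]=\{1,\dots,n\}$. A line of a cube is obtained by fixing two coordinates and letting the third vary: a row is $\{(i,j^*,k): j^*\in[n]\}$, a column is $\{(i^*,j,k): i^*\in[n]\}$, a file is $\{(i,j,k^* ):k^*\in[n]\}$. An $(m,m,m,m)$-cube of order $n$ is a cube $A$ of order $n$ in which each cell $(i,j,k)$ contains a subset $A(i,j,k)\subseteq[n]$ such that: every cell contains at most $m$ symbols, and each symbol occurs at most $m$ times in each row, at most $m$ times in each column, and at most $m$ times in each file. A Latin cube $L$ of order $n$ is a cube of order $n$ whose every cell contains one symbol $L(i,j,k)\in[n]$ such that each symbol appears exactly once in each row, column and file. $A$ is avoidable if there is a Latin cube $L$ of order $n$ with $L(i,j,k)\notin A(i,j,k)$ for all $i,j,k\in[n]$. *)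

(* Defs.v *)
From mathcomp Require Import all_boot all_order all_algebra.
Set Implicit Arguments. Unset Strict Implicit. Unset Printing Implicit Defensive.

Definition cube (n : nat) := 'I_n -> 'I_n -> 'I_n -> {set 'I_n}.

Definition mmmm_cube (n m : nat) (A : cube n) : Prop :=
  (forall i j k, #|A i j k| <= m)%N /\
  (forall s i k, #|[set j | s \in A i j k]| <= m)%N /\
  (forall s j k, #|[set i | s \in A i j k]| <= m)%N /\
  (forall s i j, #|[set k | s \in A i j k]| <= m)%N.

Definition latin_cube (n : nat) (L : 'I_n -> 'I_n -> 'I_n -> 'I_n) : Prop :=
  (forall s i k, #|[set j | L i j k == s]| = 1)%N /\
  (forall s j k, #|[set i | L i j k == s]| = 1)%N /\
  (forall s i j, #|[set k | L i j k == s]| = 1)%N.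

Definition avoidable (n : nat) (A : cube n) : Prop :=
  exists L, latin_cube L /\ forall i j k, L i j k \notin A i j k.

(* Main.v *)
Require Import Defs.
From mathcomp Require Import all_boot all_order all_algebra fingroup perm.
From mathcomp Require Import zify ring.
Import Order.TTheory GRing.Theory Num.Theory.
Set Implicit Arguments. Unset Strict Implicit. Unset Printing Implicit Defensive.

(* Splitting the rows, columns, files and symbols of a cube of order [a * b] into
   [a] classes of size [b] each reduces the problem to cubes of order [b]: block
   (x, y, z) receives the symbols of class x + y + z, and the blocks are filled
   independently of each other.

   With b = 2 ^ t and a = 2, assigning the two members of each of 2 ^ t pairs to
   the two halves by independent coin flips splits every forbidden set almost
   evenly (Chernoff), so the density m / 2 ^ t for which all cubes of order 2 ^ t
   are avoidable loses at most a factor 1 - 1 / (t + 1) ^ 2 when t grows by one.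
    The product of these factors converges, so it is enough to start from
   one large order 2 ^ t0 with m large compared to a polynomial in t0.

   For that, take b = 8 and random classes.  If m is a small power of n, with
   positive probability the forbidden (row, column, file, symbol) quadruples of
   every block lie in a 4 x 4 x 4 x 4 box, and a Latin cube of order 8 avoiding
   such a box is the Cayley cube of a group with a subgroup of index 2.  Orders
   below 2 ^ t0 are disposed of by taking gamma so small that m = 0. *)

(** * Forbidden quadruples, relabelling and block decomposition *)

Section Solvable.

Context {U : finType}.
Implicit Types A : U -> U -> U -> U -> bool.

(** [A i j k s] forbids symbol [s] in cell [(i, j, k)]. Symbols act as a fourth coordinate, which
    makes the four bounds of [codegree_le] symmetric. *)
Definition solvable A : Prop :=
  exists L : U -> U -> U -> U,
    [/\ forall i j k, ~~ A i j k (L i j k),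
        forall j k, injective (fun i => L i j k),
        forall i k, injective (fun j => L i j k) &
        forall i j, injective (fun k => L i j k)].

Definition codegree_le m A : Prop :=
  [/\ forall j k s, #|[set i | A i j k s]| <= m,
      forall i k s, #|[set j | A i j k s]| <= m,
      forall i j s, #|[set k | A i j k s]| <= m &
      forall i j k, #|[set s | A i j k s]| <= m].

Lemma codegree_leW m m' A : m <= m' -> codegree_le m A -> codegree_le m' A.
Proof.
move=> le_m [A1 A2 A3 A4].
by split=> *; apply: leq_trans le_m; [apply: A1|apply: A2|apply: A3|apply: A4].
Qed.

End Solvable.

Lemma solvable_pred0 (B : finZmodType) (A : B -> B -> B -> B -> bool) :
  (forall i j k s, ~~ A i j k s) -> solvable A.
Proof.
move=> A0; exists (fun i j k => i + j + k)%R; split=> [i j k|j k|i k|i j] //.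
- by move=> i i' /addIr/addIr.
- by move=> j j' /addIr/addrI.
- by move=> k k' /addrI.
Qed.

(** Latin cubes survive separate relabellings of rows, columns, files and symbols, so each
    coordinate can be split into classes in its own way. *)
Lemma solvable_perm {U : finType} (e1 e2 e3 e4 : U -> U)
    (A : U -> U -> U -> U -> bool) :
    bijective e1 -> bijective e2 -> bijective e3 -> bijective e4 ->
  solvable (fun i j k s => A (e1 i) (e2 j) (e3 k) (e4 s)) -> solvable A.
Proof.
move=> [f1 K1 f1K] [f2 K2 f2K] [f3 K3 f3K] [f4 K4 f4K] [L [LA L1 L2 L3]].
exists (fun i j k => e4 (L (f1 i) (f2 j) (f3 k))); split.
- by move=> i j k; have := LA (f1 i) (f2 j) (f3 k); rewrite f1K f2K f3K.
- by move=> j k i i' /(can_inj K4)/L1/(can_inj f1K).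
- by move=> i k j j' /(can_inj K4)/L2/(can_inj f2K).
- by move=> i j k k' /(can_inj K4)/L3/(can_inj f3K).
Qed.

Lemma solvable_transport {U V : finType} (f : V -> U)
    (A : U -> U -> U -> U -> bool) :
  bijective f -> solvable (fun i j k s => A (f i) (f j) (f k) (f s)) ->
  solvable A.
Proof.
move=> [g fK gK] [L [LA L1 L2 L3]].
exists (fun i j k => f (L (g i) (g j) (g k))); split.
- by move=> i j k; have := LA (g i) (g j) (g k); rewrite !gK.
- by move=> j k i i' /(can_inj fK)/L1/(can_inj gK).
- by move=> i k j j' /(can_inj fK)/L2/(can_inj gK).
- by move=> i j k k' /(can_inj fK)/L3/(can_inj gK).
Qed.

Lemma codegree_le_transport {U V : finType} (f : V -> U) m
    (A : U -> U -> U -> U -> bool) :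
  injective f -> codegree_le m A ->
  codegree_le m (fun i j k s => A (f i) (f j) (f k) (f s)).
Proof.
move=> f_inj [A1 A2 A3 A4].
have le_im (Q : pred U) : #|[set i | Q i]| <= m -> #|[set i | Q (f i)]| <= m.
  move=> leQ; rewrite -(card_imset _ f_inj); apply: leq_trans leQ.
  by apply/subset_leq_card/subsetP=> _ /imsetP[i + ->]; rewrite !inE.
by split=> *; [apply: (le_im (fun i => A i _ _ _))
  |apply: (le_im (fun j => A _ j _ _))|apply: (le_im (fun k => A _ _ k _))
  |apply: (le_im (fun s => A _ _ _ s))].
Qed.

Lemma bijective_of_card {U V : finType} :
  #|V| = #|U| -> exists f : V -> U, bijective f.
Proof.
move=> eqVU; exists (fun v => enum_val (cast_ord eqVU (enum_rank v))).
exists (fun u => enum_val (cast_ord (esym eqVU) (enum_rank u))) => z.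
  by rewrite enum_valK cast_ordK enum_rankK.
by rewrite enum_valK cast_ordKV enum_rankK.
Qed.

(* The outer Latin cube is the Cayley cube of [B]; the inner ones are chosen
   independently of each other. *)
Lemma solvable_blocks {B : finZmodType} {H : finType}
    (A : B * H -> B * H -> B * H -> B * H -> bool) :
    (forall x y z : B, solvable (fun i j k s =>
       A (x, i) (y, j) (z, k) ((x + y + z)%R, s))) ->
  solvable A.
Proof.
move=> solA.
have /fin_all_exists[L LP] : forall w : B * B * B, exists L : H -> H -> H -> H,
    [/\ forall i j k,
          ~~ A (w.1.1, i) (w.1.2, j) (w.2, k)
               ((w.1.1 + w.1.2 + w.2)%R, L i j k),
        forall j k, injective (fun i => L i j k),
        forall i k, injective (fun j => L i j k) &
        forall i j, injective (fun k => L i j k)].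
  by case=> -[x y] z; apply: solA.
exists (fun i j k =>
  ((i.1 + j.1 + k.1)%R, L (i.1, j.1, k.1) i.2 j.2 k.2)); split.
- by move=> [x i] [y j] [z k]; case: (LP (x, y, z)).
- move=> [y j] [z k] [x i] [x' i'] /= [/addIr/addIr<-].
  by case: (LP (x, y, z)) => _ L1 _ _ /L1->.
- move=> [x i] [z k] [y j] [y' j'] /= [/addIr/addrI<-].
  by case: (LP (x, y, z)) => _ _ L1 _ /L1->.
- move=> [x i] [y j] [z k] [z' k'] /= [/addrI<-].
  by case: (LP (x, y, z)) => _ _ _ L1 /L1->.
Qed.

Definition order_solvable n m : Prop :=
  forall A : 'I_n -> 'I_n -> 'I_n -> 'I_n -> bool,
    codegree_le m A -> solvable A.

Lemma order_solvableW n m m' :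
  m' <= m -> order_solvable n m -> order_solvable n m'.
Proof. by move=> le_m sol A /(codegree_leW le_m)/sol. Qed.

(** * Union bound *)

Lemma leq_cardsU {T : finType} (X Y : {set T}) p q :
  #|X| <= p -> #|Y| <= q -> #|X :|: Y| <= p + q.
Proof.
by move=> leX leY; apply: leq_trans (leq_add leX leY); rewrite cardsU leq_subr.
Qed.

Lemma leq_card_bigcup {I T : finType} (Q : pred I) (F : I -> {set T}) :
  #|\bigcup_(i | Q i) F i| <= \sum_(i | Q i) #|F i|.
Proof.
elim/big_rec2: _ => [|i s S _ IH]; first by rewrite cards0.
exact: leq_cardsU.
Qed.

Lemma union_bound {W I : finType} (bad : I -> {set W}) q :
    0 < #|W| -> #|I| < q -> (forall i, #|bad i| * q <= #|W|) ->
  exists w, forall i, w \notin bad i.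
Proof.
move=> W0 ltIq le_bad.
have /subsetPn[w _ wP] : ~~ ([set: W] \subset \bigcup_i bad i).
  apply/negP => /subset_leq_card; rewrite cardsT => leW.
  have: #|W| * q <= #|I| * #|W|.
    apply: (leq_trans (leq_mul leW (leqnn q))).
    apply: (@leq_trans (\sum_(i : I) #|bad i| * q)).
      by rewrite -big_distrl leq_mul2r leq_card_bigcup orbT.
    by rewrite -sum_nat_const leq_sum.
  by rewrite mulnC leq_pmul2r // leqNgt ltIq.
by exists w => i; apply: contra wP => wi; apply/bigcupP; exists i.
Qed.

(** * Halving the order by coin flips *)

Lemma expSn_ge_double q : 0 < q -> 2 * q ^ q <= q.+1 ^ q.
Proof.
(* Bernoulli's inequality for (1 + 1/q)^l, cleared of denominators. *)
move=> q0; suff bern l : q ^ l * (q + l) <= q * q.+1 ^ l.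
  by have := bern q; nia.
elim: l => [|l IH]; first by lia.
by rewrite !expnS; nia.
Qed.

(** Bernoulli's inequality gives (1 - 1/(2k))^k >= 1/2, which is then squared. *)
Lemma exp_pred_ge_quarter k : 0 < k -> k.*2 ^ k.*2 <= 4 * k.*2.-1 ^ k.*2.
Proof.
move=> k0; have bern l : l <= k -> k.*2 ^ l * (k.*2 - l) <= k.*2 * k.*2.-1 ^ l.
  elim: l => [|l IH] lk; first by lia.
  have {}IH := IH (ltnW lk); move: IH; rewrite !expnS.
  set X := k.*2 ^ l; set Y := k.*2.-1 ^ l => IH.
  by nia.
have half : k.*2 ^ k <= 2 * k.*2.-1 ^ k by have := bern k (leqnn k); nia.
have dblE x : x ^ k.*2 = x ^ k * x ^ k by rewrite -addnn expnD.
by rewrite !dblE; nia.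
Qed.

(* Each element of a pair is given the weight [1 + 1/q] or [1 - 1/q], with
   [q = p.+1], according to the half it is sent to. *)
Lemma sum_coin_weights {H : finType} (f : H -> 'I_2 -> bool) p (x : 'I_2) :
  \sum_(c : {ffun H -> 'I_2})
     p.+2 ^ (\sum_i f i (x + c i)%R) * p ^ (\sum_i f i (x + c i + 1)%R)
  <= 2 ^ #|H| * p.+1 ^ (\sum_i (f i 0%R + f i 1%R)).
Proof.
pose w i b := p.+2 ^ f i (x + b)%R * p ^ f i (x + b + 1)%R.
(* By independence the sum over [c] factors over [i]. A factor is 2, 2(p+1) or 2p(p+2) <= 2(p+1)^2,
   according to how many of [f i 0], [f i 1] hold. *)
rewrite (eq_bigr (fun c : {ffun H -> 'I_2} => \prod_i w i (c i))); last first.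
  by move=> c _; rewrite big_split /= !expn_sum.
rewrite -bigA_distr_bigA /= expn_sum -prod_nat_const -big_split /=.
apply: leq_prod => i _; rewrite big_ord_recl big_ord1 /w {w}.
have -> : lift ord0 ord0 = 1%R :> 'I_2 by apply/val_inj.
have -> : ord0 = 0%R :> 'I_2 by apply/val_inj.
have [->|->] : x = 0%R \/ x = 1%R.
- by case: x => [[|[|//]]] ?; [left|right]; apply/val_inj.
- rewrite !(add0r, addr0) (_ : 1 + 1 = 0 :> 'I_2)%R; last exact/val_inj.
  by case: (f i 0%R) (f i 1%R) => [] [] /=; rewrite ?(expn0, expn1) //; nia.
- rewrite !(add0r, addr0) (_ : 1 + 1 = 0 :> 'I_2)%R; last exact/val_inj.
  rewrite add0r.
  by case: (f i 0%R) (f i 1%R) => [] [] /=; rewrite ?(expn0, expn1) //; nia.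
Qed.

Lemma leq_exp_base a b e : a <= b -> a ^ e <= b ^ e.
Proof. by case: e => // e leab; rewrite leq_exp2r. Qed.

(** Let q = 2k. Pairing the [z] factors 1 - 1/q with as many factors 1 + 1/q gives (1 - 1/q^2)^z >=
    4^(-v); a further q u factors 1 + 1/q give at least 2^u. *)
Lemma coin_weight_ge k u v w cnt z :
    0 < k -> z <= k.*2 ^ 2 * v -> z + k.*2 * u <= cnt -> 2 * v + w <= u ->
  2 ^ w * k.*2 ^ (cnt + z) <= k.*2.+1 ^ cnt * k.*2.-1 ^ z.
Proof.
move=> k0 le_z le_cnt le_u.
have qqE : k.*2 ^ 2 = (k * k.*2).*2 by rewrite expnS expn1; lia.
set q := k.*2 in le_z le_cnt qqE *; have q1 : 1 < q by rewrite /q; lia.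
have up : 2 ^ u * q ^ (q * u) <= q.+1 ^ (q * u).
  by rewrite !expnM -expnMn leq_exp_base // expSn_ge_double //; lia.
have [e De] : exists e, cnt = z + q * u + e by exists (cnt - (z + q * u)); lia.
have low : q ^ (2 * z) <= 4 ^ v * (q ^ 2).-1 ^ z.
  rewrite expnM; have Q1 : 1 < q ^ 2 by rewrite (ltn_exp2l 0).
  have quart : (q ^ 2) ^ (q ^ 2 * v) <= 4 ^ v * (q ^ 2).-1 ^ (q ^ 2 * v).
    rewrite qqE !(expnM _ (k * q).*2) -expnMn leq_exp_base //.
    by apply: exp_pred_ge_quarter; lia.
  set Q := q ^ 2 in le_z Q1 quart *.
  rewrite -(subnK le_z) !expnD in quart.
  have pow0 : 0 < Q.-1 ^ (Q * v - z) by rewrite expn_gt0; lia.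
  rewrite -(leq_pmul2l pow0) mulnCA; apply: leq_trans quart.
  by rewrite leq_mul2r leq_exp_base ?orbT //; lia.
have four0 : 0 < 4 ^ v by rewrite expn_gt0.
rewrite -(leq_pmul2l four0) De.
have -> : q.+1 ^ (z + q * u + e) * q.-1 ^ z =
          (q ^ 2).-1 ^ z * q.+1 ^ (q * u) * q.+1 ^ e.
  have -> : (q ^ 2).-1 = q.+1 * q.-1 by rewrite expnS expn1; nia.
  by rewrite expnMn !expnD; ring.
rewrite !mulnA.
apply: (@leq_trans (q ^ (2 * z) * (2 ^ u * q ^ (q * u)) * q ^ e)).
  have -> : q ^ (z + q * u + e + z) = q ^ (2 * z) * q ^ (q * u) * q ^ e.
    by rewrite -!expnD; congr (q ^ _); lia.
  have -> : 4 ^ v * 2 ^ w = 2 ^ (2 * v + w) by rewrite expnD expnM.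
  have: 2 ^ (2 * v + w) <= 2 ^ u by rewrite leq_exp2l.
  by move: (2 ^ _) (2 ^ u) => a b leab; rewrite !mulnA !leq_mul2r
     [_ * b]mulnC leq_mul2r leab !orbT.
by rewrite !leq_mul // leq_exp_base.
Qed.

(** Markov's inequality for the weights, with q = 2k: a bad [c] weighs at least 2^w q^|D|, while the
    total weight is at most 2^|H| q^|D|. *)
Lemma card_coin_bad {H : finType} (D : {set 'I_2 * H}) (x : 'I_2) m m' k u v w :
    0 < k -> #|D| <= m -> m' <= k.*2 ^ 2 * v -> m + k.*2 * u <= 2 * m' ->
    2 * v + w <= u ->
  #|[set c : {ffun H -> 'I_2} | m' < #|[set i | ((x + c i)%R, i) \in D]|]|
    * 2 ^ w <= #|{ffun H -> 'I_2}|.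
Proof.
move=> k0 leD le_m' le_m le_u.
pose f i b := (b, i) \in D.
pose cnt (c : {ffun H -> 'I_2}) := \sum_i f i (x + c i)%R.
pose z (c : {ffun H -> 'I_2}) := \sum_i f i (x + c i + 1)%R.
have cntE (c : {ffun H -> 'I_2}) : #|[set i | ((x + c i)%R, i) \in D]| = cnt c.
  rewrite -sum1dep_card big_mkcond; apply: eq_bigr => i _.
  by rewrite /f; case: in_mem.
have DE : #|D| = \sum_i (f i 0%R + f i 1%R).
  rewrite -sum1_card big_mkcond (eq_bigr (fun a => nat_of_bool (f a.2 a.1))).
    rewrite -(pair_bigA _ (fun b i => nat_of_bool (f i b))) exchange_big /=.
    apply: eq_bigr => i _; rewrite big_ord_recl big_ord1.
    by congr (nat_of_bool (f i _) + nat_of_bool (f i _)); apply/val_inj.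
  by case=> b i _; rewrite /f /=; case: in_mem.
have czE c : cnt c + z c = #|D|.
  rewrite DE -big_split; apply: eq_bigr => i _ /=.
  have [->|->] : (x + c i)%R = 0%R \/ (x + c i)%R = 1%R.
  - by case: (x + c i)%R => [[|[|//]]] ?; [left|right]; apply/val_inj.
  - by rewrite add0r.
  - by rewrite addnC (_ : 1 + 1 = 0 :> 'I_2)%R //; apply/val_inj.
have q0 : 0 < k.*2 ^ #|D| by rewrite expn_gt0; lia.
rewrite card_ffun card_ord -(leq_pmul2r q0) -mulnA.
have := sum_coin_weights f k.*2.-2.+1 x.
rewrite -DE (_ : k.*2.-2.+2 = k.*2) ?(_ : k.*2.-2.+3 = k.*2.+1); try lia.
rewrite (_ : k.*2.-2.+1 = k.*2.-1); last by lia.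
apply: leq_trans; rewrite -sum_nat_const big_mkcond /=.
apply: leq_sum => c _; rewrite inE cntE -/(z c).
case: ifP => // lt_c.
rewrite -(czE c); apply: (coin_weight_ge (u := u) (v := v)) => //.
  by have := czE c; lia.
by have := czE c; lia.
Qed.

Lemma halving_bijection {H I : finType} (D : I -> {set 'I_2 * H}) m m' k u v w :
    0 < k -> (forall f, #|D f| <= m) -> #|I| * 2 < 2 ^ w ->
    m' <= k.*2 ^ 2 * v -> m + k.*2 * u <= 2 * m' -> 2 * v + w <= u ->
  exists2 e : 'I_2 * H -> 'I_2 * H, bijective e &
    forall f x, #|[set i | e (x, i) \in D f]| <= m'.
Proof.
move=> k0 leD ltI le_m' le_m le_u.
have [||f|c cP] := @union_bound {ffun H -> 'I_2} (I * 'I_2)%type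
  (fun f => [set c : {ffun H -> 'I_2} |
     m' < #|[set i | ((f.2 + c i)%R, i) \in D f.1]|]) (2 ^ w).
- by rewrite card_ffun card_ord expn_gt0.
- by rewrite card_prod card_ord.
- exact: (card_coin_bad f.2 k0 (leD f.1) le_m' le_m le_u).
(* The two members of pair [i] are swapped exactly when [c i] is 1. *)
exists (fun a => ((a.1 + c a.2)%R, a.2)).
  by exists (fun a => ((a.1 - c a.2)%R, a.2)) => -[x i];
    rewrite /= ?addrK ?subrK.
by move=> f x; have := cP (f, x); rewrite inE -leqNgt.
Qed.

(** Each union bound runs over all triples of the other coordinates in the whole cube, so each
    bijection works whatever the other three are. *)
Lemma halving_step t m m' k u v :
    0 < k -> m' <= k.*2 ^ 2 * v -> m + k.*2 * u <= 2 * m' ->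
    2 * v + (3 * t + 5) <= u ->
  order_solvable (2 ^ t) m' -> order_solvable (2 ^ t.+1) m.
Proof.
move=> k0 le_m' le_m le_u sol A codegA.
pose V : finType := ('I_2 * 'I_(2 ^ t))%type.
have cardV : #|V| = 2 ^ t.+1 by rewrite card_prod !card_ord expnS.
have [|f bij_f] := @bijective_of_card 'I_(2 ^ t.+1) V.
  by rewrite cardV card_ord.
apply: (solvable_transport bij_f).
have := codegree_le_transport (bij_inj bij_f) codegA.
move: (fun i j k s => _) => {codegA f bij_f}A [A1 A2 A3 A4].
(* Two halves and (2^(t+1))^3 triples make 2^(3t+4) events. *)
have ltV : #|{: V * V * V}| * 2 < 2 ^ (3 * t + 5).
  rewrite !card_prod !card_ord -expnS -!expnD -[X in _ * X]expn1 -expnD.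
  by rewrite ltn_exp2l //; lia.
have [e1 bij1 P1] := halving_bijection
  (D := fun w : V * V * V => [set i | A i w.1.1 w.1.2 w.2]) k0
  (fun w => A1 _ _ _) ltV le_m' le_m le_u.
have [e2 bij2 P2] := halving_bijection
  (D := fun w : V * V * V => [set j | A w.1.1 j w.1.2 w.2]) k0
  (fun w => A2 _ _ _) ltV le_m' le_m le_u.
have [e3 bij3 P3] := halving_bijection
  (D := fun w : V * V * V => [set k | A w.1.1 w.1.2 k w.2]) k0
  (fun w => A3 _ _ _) ltV le_m' le_m le_u.
have [e4 bij4 P4] := halving_bijection
  (D := fun w : V * V * V => [set s | A w.1.1 w.1.2 w.2 s]) k0
  (fun w => A4 _ _ _) ltV le_m' le_m le_u.
apply: (solvable_perm bij1 bij2 bij3 bij4); apply: solvable_blocks => x y z.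
apply: sol; split=> [j l s|i l s|i j s|i j l].
- have := P1 (e2 (y, j), e3 (z, l), e4 ((x + y + z)%R, s)) x.
  by under eq_finset do rewrite inE.
- have := P2 (e1 (x, i), e3 (z, l), e4 ((x + y + z)%R, s)) y.
  by under eq_finset do rewrite inE.
- have := P3 (e1 (x, i), e2 (y, j), e4 ((x + y + z)%R, s)) z.
  by under eq_finset do rewrite inE.
- have := P4 (e1 (x, i), e2 (y, j), e3 (z, l)) (x + y + z)%R.
  by under eq_finset do rewrite inE.
Qed.

(** The invariant says m / 2^t >= (1 + 1/t) / K. Passing from 1 + 1/t to 1 + 1/(t+1) loses exactly
    the factor 1 - 1/(t+1)^2, so the product telescopes. *)
Lemma halving_invariant K t m :
    0 < t -> 14 * t.+1 ^ 5 <= m -> order_solvable (2 ^ t) m ->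
    t.+1 * 2 ^ t <= K * t * m ->
  exists2 m2, order_solvable (2 ^ t.+1) m2 & t.+2 * 2 ^ t.+1 <= K * t.+1 * m2.
Proof.
move=> t0 le_m sol inv.
(* The [+ 1] ensures m <= q^2 v. The loss [d] satisfies x^2 d <= m + 2 x^4 (3x + 4), and the last
   term is at most 14 x^5 <= m. *)
pose x := t.+1; pose q := (x ^ 2).*2; pose v := m %/ q ^ 2 + 1.
pose d := q * (2 * v + (3 * t + 5)).
have qE : q = 2 * x ^ 2 by rewrite /q; lia.
have q0 : 0 < q ^ 2 by rewrite qE !expn_gt0.
have x20 : 0 < x ^ 2 by rewrite expn_gt0.
have le_d : x ^ 2 * d <= 2 * m.
  have -> : x ^ 2 * d = m %/ q ^ 2 * q ^ 2 + 2 * x ^ 4 * (3 * x + 4).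
    by rewrite /d /v qE /x; ring.
  have := leq_divM m (q ^ 2); move: le_m.
  rewrite -/x expnS; move: (x ^ 4) => y.
  by have : 0 < x by []; nia.
have le_d2 : d <= 2 * m by apply: leq_trans le_d; rewrite leq_pmull.
exists (2 * m - d).
  apply: (halving_step (k := x ^ 2) (v := v) _ _ _ (leqnn _) sol) => //.
  - by rewrite -/q /v addn1 mulnC ltnW // ltn_ceil.
  - by rewrite -/q -/d subnK.
have le_m2 : 2 * m * (t * t.+2) <= x ^ 2 * (2 * m - d).
  have x2E : x ^ 2 = t * t.+2 + 1 by rewrite /x; ring.
  rewrite mulnBr {1}x2E; move: (t * _) (x ^ 2 * d) le_d => a b leb.
  by rewrite mulnDl mul1n mulnC; lia.
rewrite -(leq_pmul2l x20) mulnCA -/x.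
rewrite [_ * (2 * m - d)]mulnC [x ^ 2 * (_ * _)]mulnA.
apply: (@leq_trans (2 * m * (t * t.+2) * (K * x))); last first.
  by rewrite leq_mul2r le_m2 orbT.
have -> : t.+2 * (x ^ 2 * 2 ^ t.+1) = x * t.+2 * 2 * (x * 2 ^ t).
  by rewrite (expnS 2) expnS expn1; ring.
have -> : 2 * m * (t * t.+2) * (K * x) = x * t.+2 * 2 * (K * t * m) by ring.
by rewrite leq_mul2l inv orbT.
Qed.

(** * A starting order: boxes and random shifts *)

Lemma perm_into {T : finType} (X Y : {set T}) :
  #|X| <= #|Y| -> exists s : {perm T}, forall x, x \in X -> s x \in Y.
Proof.
have [n] := ubnP #|X :\: Y|; elim: n X => // n IH X ltn leXY.
have [sXY|/subsetPn[x Xx Yx]] := boolP (X \subset Y).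
  by exists 1%g => x Xx; rewrite perm1 (subsetP sXY).
have [y Yy Xy] : exists2 y, y \in Y & y \notin X.
  apply/subsetPn; apply: contra Yx => sYX.
  have /eqP -> // : Y == X by rewrite eqEcard sYX leXY.
(* Trading [x] for [y] shrinks [X :\: Y], and [tperm x y] carries [X] to [X']. *)
pose X' := y |: (X :\ x).
have cardX' : #|X'| = #|X|.
  by rewrite cardsU1 (cardsD1 x X) Xx !inE (negPf Xy) andbF.
have [||s sP] := IH X'; rewrite ?cardX' //.
  rewrite ltnS in ltn; apply: leq_trans ltn; apply: proper_card.
  have xy : x != y by apply: contraNneq Yx => ->.
  apply/properP; split; last first.
    by exists x; rewrite !inE ?Xx ?Yx ?(negPf xy) ?eqxx.
  apply/subsetP => z; rewrite !inE => /andP[Yz /orP[/eqP zy|/andP[_ ->]]].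
    by rewrite zy Yy in Yz.
  by rewrite Yz.
exists (tperm x y * s)%g => z Xz; rewrite permM.
case: tpermP => [_|zy|/eqP zx /eqP zy].
- by apply: sP; rewrite !inE eqxx.
- by rewrite zy (negPf Xy) in Xz.
- by apply: sP; rewrite !inE Xz zx orbT.
Qed.

(* Placing the forbidden rows, columns and files in the first half and the
   forbidden symbols in the second half leaves no conflict, since [0 + 0 + 0]
   is not [1]. *)
Lemma solvable_box (U : finZmodType)
    (A : 'I_2 * U -> 'I_2 * U -> 'I_2 * U -> 'I_2 * U -> bool)
    (X1 X2 X3 X4 : {set 'I_2 * U}) :
    #|X1| <= #|U| -> #|X2| <= #|U| -> #|X3| <= #|U| -> #|X4| <= #|U| ->
    (forall i j k s, A i j k s ->
       [/\ i \in X1, j \in X2, k \in X3 & s \in X4]) ->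
  solvable A.
Proof.
pose half (b : 'I_2) := [set a : 'I_2 * U | a.1 == b].
have card_half b : #|half b| = #|U|.
  have -> : half b = setX [set b] [set: U].
    by apply/setP => a; rewrite !inE andbT.
  by rewrite cardsX cards1 cardsT mul1n.
rewrite -{1 2 3}(card_half 0%R) -(card_half 1%R).
move=> /perm_into[s1 P1] /perm_into[s2 P2] /perm_into[s3 P3].
move=> /perm_into[s4 P4] AX.
have bijV (s : {perm 'I_2 * U}) : bijective (s^-1)%g.
  by apply: (@Bijective _ _ _ s) => a; rewrite ?permK ?permKV.
apply: (solvable_perm (bijV s1) (bijV s2) (bijV s3) (bijV s4)).
apply: solvable_blocks => x y z; apply: solvable_pred0 => i j k s.
apply/negP => /AX[/P1 + /P2 + /P3 + /P4]; rewrite !permKV !inE /=.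
by do 3! move/eqP => ->; rewrite !addr0.
Qed.

(** There are at most 2^|H| candidates for the set [J] of hit indices. For each, independence leaves
    at most M^|J| |B|^(|H|-|J|) shifts, which is largest at |J| = g since M <= |B|. *)
Lemma card_shift_hits {B : finZmodType} {H : finType} (D : {set B * H})
    (x : B) M g :
    #|D| <= M -> M <= #|B| -> g <= #|H| ->
  #|[set r : {ffun H -> B} | g <= #|[set u | ((x + r u)%R, u) \in D]|]|
    <= 2 ^ #|H| * (M ^ g * #|B| ^ (#|H| - g)).
Proof.
move=> leD leM leg.
pose F (J : {set H}) (u : H) :=
  if u \in J then [pred b | ((x + b)%R, u) \in D] else predT.
apply: (@leq_trans (\sum_(J : {set H} | g <= #|J|) #|family (F J)|)).
  apply: (@leq_trans
    #|\bigcup_(J : {set H} | g <= #|J|) [set r in family (F J)]|).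
    apply/subset_leq_card/subsetP => r; rewrite inE => le_r.
    apply/bigcupP; eexists; first exact: le_r.
    rewrite inE; apply/familyP => u; rewrite /F; case: ifP => //.
    by rewrite !inE.
  apply: leq_trans (leq_card_bigcup _ _) _; apply: leq_sum => J _.
  by rewrite cardsE.
apply: (@leq_trans (\sum_(J : {set H} | g <= #|J|) M ^ g * #|B| ^ (#|H| - g))).
  apply: leq_sum => J le_J; rewrite card_family foldrE big_map big_enum /=.
  apply: (@leq_trans (\prod_u (if u \in J then M else #|B|))).
    apply: leq_prod => u _; rewrite /F; case: ifP => // _.
    apply: leq_trans leD.
    have inj : injective (fun b : B => ((x + b)%R, u)) by move=> b b' [/addrI].
    rewrite -(card_image inj); apply/subset_leq_card/subsetP.
    by move=> _ /imageP[b + ->]; rewrite !inE.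
  rewrite (bigID (mem J)) /= (eq_bigr (fun=> M)); last by move=> u ->.
  rewrite [X in _ * X](eq_bigr (fun=> #|B|)); last by move=> u /negPf->.
  rewrite !prod_nat_const.
  have -> : #|[pred u | u \notin J]| = #|H| - #|J| by rewrite -(cardC J) addKn.
  rewrite -{1}(subnKC le_J) expnD -mulnA leq_mul2l; apply/orP; right.
  have -> : #|H| - g = (#|J| - g) + (#|H| - #|J|).
    have : #|J| <= #|H| by apply: max_card.
    by move: #|J| #|H| le_J => a b; lia.
  by rewrite expnD leq_mul2r leq_exp_base ?orbT.
rewrite sum_nat_const leq_mul2r; apply/orP; right.
have -> : 2 ^ #|H| = #|{set H}|
  by rewrite -[RHS]cardsT -powersetT card_powerset cardsT.
exact: max_card.
Qed.

(** Conditioning on [g w]; it will be used for one random shift given the other three. *)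
Lemma card_fibers {W W1 W2 : finType} (f : W -> W1) (g : W -> W2)
    (Q : W1 -> W2 -> bool) K :
    injective (fun w => (f w, g w)) ->
    (forall w2, #|[set w1 | Q w1 w2]| <= K) ->
  #|[set w | Q (f w) (g w)]| <= K * #|W2|.
Proof.
move=> inj leK; rewrite -(card_imset _ inj).
apply: (@leq_trans #|[set w | Q w.1 w.2]|).
  by apply/subset_leq_card/subsetP => _ /imsetP[w + ->]; rewrite !inE.
rewrite -sum1dep_card (eq_bigl (fun w => true && Q w.1 w.2)) //.
rewrite -(pair_big_dep predT Q (fun _ _ => 1)) (exchange_big_dep predT) //=.
rewrite mulnC -sum_nat_const; apply: leq_sum => w2 _.
by rewrite sum1dep_card.
Qed.

Lemma card_exists_le {V P : finType} (Q : P -> pred V) m :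
    (forall p, #|[set v | Q p v]| <= m) ->
  #|[set v | [exists p, Q p v]]| <= #|P| * m.
Proof.
move=> leQ; rewrite -sum_nat_const.
apply: (@leq_trans #|\bigcup_p [set v | Q p v]|).
  apply/subset_leq_card/subsetP => v; rewrite inE => /existsP[p Qpv].
  by apply/bigcupP; exists p; rewrite ?inE.
by apply: leq_trans (leq_card_bigcup _ _) _; apply: leq_sum.
Qed.

(* A random shift of each residue class makes the elements of a block
   independent; five forbidden rows, columns, files or symbols in one of the
   [#|B| ^ 3] blocks are then too unlikely to occur. *)
Lemma solvable_sparse {B : finZmodType} m
    (A : B * ('I_2 * 'I_4) -> B * ('I_2 * 'I_4) -> B * ('I_2 * 'I_4) ->
         B * ('I_2 * 'I_4) -> bool) :
    512 * m <= #|B| -> 2 ^ 11 * (512 * m) ^ 5 <= #|B| ^ 2 ->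
    codegree_le m A ->
  solvable A.
Proof.
pose H : finType := ('I_2 * 'I_4)%type; pose V : finType := (B * H)%type.
pose G : finType := {ffun H -> B}; pose P : finType := (H * H * H)%type.
have cardH : #|H| = 8 by rewrite card_prod !card_ord.
set M := 512 * m; set b := #|B| => leM le_b [A1 A2 A3 A4].
have cardP : #|P| * m = M by rewrite !card_prod !card_ord.
have cardG : #|G| = b ^ 8 by rewrite card_ffun cardH.
have b0 : 0 < b by apply/card_gt0P; exists 0%R.
pose e (r : G) (a : V) : V := ((a.1 + r a.2)%R, a.2).
have bij_e r : bijective (e r).
  by exists (fun a => ((a.1 - r a.2)%R, a.2)) => -[x u];
    rewrite /e /= ?addrK ?subrK.
pose hit (r : G) (x : B) (D : {set V}) := [set u | e r (x, u) \in D].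
(* Rows in conflict with some column, file and symbol of the given classes: at most 8^3 m = M of
   them, and the shift of the rows does not enter. *)
pose D1 y z w (g : G * G * G) := [set v | [exists p : P,
  A v (e g.1.1 (y, p.1.1)) (e g.1.2 (z, p.1.2)) (e g.2 (w, p.2))]].
pose D2 x z w (g : G * G * G) := [set v | [exists p : P,
  A (e g.1.1 (x, p.1.1)) v (e g.1.2 (z, p.1.2)) (e g.2 (w, p.2))]].
pose D3 x y w (g : G * G * G) := [set v | [exists p : P,
  A (e g.1.1 (x, p.1.1)) (e g.1.2 (y, p.1.2)) v (e g.2 (w, p.2))]].
pose D4 x y z (g : G * G * G) := [set v | [exists p : P,
  A (e g.1.1 (x, p.1.1)) (e g.1.2 (y, p.1.2)) (e g.2 (z, p.2)) v]].
pose W : finType := (G * G * G * G)%type.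
have bad_le (f : W -> G) (g : W -> G * G * G) x (D : G * G * G -> {set V}) :
    injective (fun w => (f w, g w)) -> (forall w, #|D w| <= M) ->
    #|[set w | 4 < #|hit (f w) x (D (g w))|]|
      <= 2 ^ 8 * (M ^ 5 * b ^ 3) * b ^ 24.
  move=> inj leD.
  have -> : b ^ 24 = #|{: G * G * G}| by rewrite !card_prod cardG -!expnD.
  apply: (card_fibers (Q := fun r w => 4 < #|hit r x (D w)|)) => // w.
  have := @card_shift_hits B H (D w) x M 5 (leD w) leM.
  by rewrite cardH; apply.
pose r1 (w : W) := w.1.1.1; pose r2 (w : W) := w.1.1.2.
pose r3 (w : W) := w.1.2; pose r4 (w : W) := w.2.
have W_inj w w' : r1 w = r1 w' -> r2 w = r2 w' -> r3 w = r3 w' ->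
    r4 w = r4 w' -> w = w'.
  case: w w' => [[[? ?] ?] ?] [[[? ?] ?] ?].
  by rewrite /r1 /r2 /r3 /r4 /= => -> -> -> ->.
pose g1 w := (r2 w, r3 w, r4 w); pose g2 w := (r1 w, r3 w, r4 w).
pose g3 w := (r1 w, r2 w, r4 w); pose g4 w := (r1 w, r2 w, r3 w).
pose bad1 c := [set w | 4 < #|hit (r1 w) c.1.1
  (D1 c.1.2 c.2 (c.1.1 + c.1.2 + c.2)%R (g1 w))|].
pose bad2 c := [set w | 4 < #|hit (r2 w) c.1.2
  (D2 c.1.1 c.2 (c.1.1 + c.1.2 + c.2)%R (g2 w))|].
pose bad3 c := [set w | 4 < #|hit (r3 w) c.2
  (D3 c.1.1 c.1.2 (c.1.1 + c.1.2 + c.2)%R (g3 w))|].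
pose bad4 c := [set w | 4 < #|hit (r4 w) (c.1.1 + c.1.2 + c.2)%R
  (D4 c.1.1 c.1.2 c.2 (g4 w))|].
have le1 c : #|bad1 c| <= 2 ^ 8 * (M ^ 5 * b ^ 3) * b ^ 24.
  apply: bad_le => [w w' [? ? ? ?]|w]; first exact: W_inj.
  by rewrite -cardP; apply: card_exists_le.
have le2 c : #|bad2 c| <= 2 ^ 8 * (M ^ 5 * b ^ 3) * b ^ 24.
  apply: bad_le => [w w' [? ? ? ?]|w]; first exact: W_inj.
  by rewrite -cardP; apply: card_exists_le.
have le3 c : #|bad3 c| <= 2 ^ 8 * (M ^ 5 * b ^ 3) * b ^ 24.
  apply: bad_le => [w w' [? ? ? ?]|w]; first exact: W_inj.
  by rewrite -cardP; apply: card_exists_le.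
have le4 c : #|bad4 c| <= 2 ^ 8 * (M ^ 5 * b ^ 3) * b ^ 24.
  apply: bad_le => [w w' [? ? ? ?]|w]; first exact: W_inj.
  by rewrite -cardP; apply: card_exists_le.
(* The factor 2 makes the number b^3 of blocks strictly smaller than the bound. The four events of a
   block together have density at most 4 * 2^8 (M/b)^5. *)
have [||c|w wP] := @union_bound W (B * B * B)%type
  (fun c => bad1 c :|: bad2 c :|: bad3 c :|: bad4 c) (2 * b ^ 3).
- by rewrite !card_prod cardG -!expnD expn_gt0 b0.
- rewrite !card_prod -/b (_ : b * b * b = b ^ 3); last by ring.
  by have : 0 < b ^ 3; [rewrite expn_gt0 b0 | lia].
- set K := 2 ^ 8 * (M ^ 5 * b ^ 3) * b ^ 24 in le1 le2 le3 le4 *.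
  apply: (@leq_trans ((K + K + K + K) * (2 * b ^ 3))).
    rewrite leq_mul2r; apply/orP; right.
    exact: leq_cardsU (leq_cardsU (leq_cardsU (le1 c) (le2 c)) (le3 c)) (le4 c).
  have -> : (K + K + K + K) * (2 * b ^ 3) = 2 ^ 11 * M ^ 5 * b ^ 30.
    by rewrite /K; ring.
  have -> : #|W| = b ^ 2 * b ^ 30 by rewrite !card_prod cardG -!expnD.
  by rewrite leq_mul2r le_b orbT.
apply: (solvable_perm (bij_e (r1 w)) (bij_e (r2 w))
                      (bij_e (r3 w)) (bij_e (r4 w))).
apply: solvable_blocks => x y z.
have := wP (x, y, z); rewrite !inE !negb_or -!leqNgt /=.
move=> /andP[/andP[/andP[h1 h2] h3] h4].
(* At most four hits per coordinate fit into one half of the block of order 8. *)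
apply: solvable_box; rewrite ?card_ord;
  [exact: h1|exact: h2|exact: h3|exact: h4|].
move=> i j k s Aijks; split; rewrite !inE; apply/existsP.
- by exists (j, k, s).
- by exists (i, k, s).
- by exists (i, j, s).
- by exists (i, j, k).
Qed.

Lemma sparse_order_solvable a c :
  c + 9 <= a -> 5 * c + 56 <= 2 * a -> order_solvable (2 ^ (a + 3)) (2 ^ c).
Proof.
move=> le1 le2 A codegA.
(* The successor form lets the ordinals carry their cyclic group structure. *)
pose V : finType := ('I_(2 ^ a).-1.+1 * ('I_2 * 'I_4))%type.
have a0 : 0 < 2 ^ a by rewrite expn_gt0.
have [|f bij_f] := @bijective_of_card 'I_(2 ^ (a + 3)) V.
  by rewrite !card_prod !card_ord prednK // expnD.
have powE : 512 * 2 ^ c = 2 ^ (9 + c) by rewrite expnD.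
apply: (solvable_transport bij_f); apply: (@solvable_sparse _ (2 ^ c)).
- by rewrite card_ord prednK // powE leq_exp2l //; lia.
- by rewrite card_ord prednK // powE -!expnM -expnD leq_exp2l //; lia.
- exact: (codegree_le_transport (bij_inj bij_f) codegA).
Qed.

(** * Constants and the linear bound *)

Lemma quintic_le_pow2 s : (161 + s) ^ 5 <= 2 ^ (41 + s).
Proof.
elim: s => [|s IH].
  rewrite !addn0; apply: (@leq_trans ((2 ^ 8) ^ 5)); first exact: leq_exp_base.
  by rewrite -expnM leq_exp2l.
rewrite !addnS (expnS 2); apply: leq_trans (leq_mul (leqnn 2) IH).
(* One step multiplies the left side by at most (8/7)^5 < 2. *)
have le_y : 7 * (161 + s).+1 <= 8 * (161 + s) by lia.
have := leq_exp_base 5 le_y; rewrite !expnMn.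
have le87 : 8 ^ 5 <= 7 ^ 5 * 2 by [].
have gt0 : 0 < 7 ^ 5 by rewrite expn_gt0.
move=> le_xy; rewrite -(leq_pmul2l gt0) mulnA; apply: leq_trans le_xy _.
by rewrite leq_mul2r le87 orbT.
Qed.

(** The invariant implies 2^t <= K m, and [large] turns this into the bound 14 (t+1)^5 <= m that the
    next halving step requires. *)
Lemma order_solvable_doubling t0 K m0 :
    0 < t0 -> 0 < K -> order_solvable (2 ^ t0) m0 ->
    t0.+1 * 2 ^ t0 <= K * t0 * m0 ->
    (forall s, K * (14 * (t0 + s).+1 ^ 5) <= 2 ^ (t0 + s)) ->
  forall s, exists2 m, order_solvable (2 ^ (t0 + s)) m & 2 ^ (t0 + s) <= K * m.
Proof.
move=> t00 K0 sol0 inv0 large.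
have weaken s m : (t0 + s).+1 * 2 ^ (t0 + s) <= K * (t0 + s) * m ->
    2 ^ (t0 + s) <= K * m.
  have: 0 < t0 + s by rewrite addn_gt0 t00.
  move: (t0 + s) => t gt0 inv; rewrite -(leq_pmul2l gt0).
  apply: leq_trans (leq_trans _ inv) _; first by rewrite leq_mul2r leqnSn orbT.
  by rewrite mulnA [t * _]mulnC.
suff inv s : exists2 m, order_solvable (2 ^ (t0 + s)) m &
    (t0 + s).+1 * 2 ^ (t0 + s) <= K * (t0 + s) * m.
  by move=> s; have [m ? /weaken ?] := inv s; exists m.
elim: s => [|s [m sol inv]]; first by exists m0; rewrite addn0.
rewrite addnS; apply: (halving_invariant _ _ sol inv).
  by rewrite addn_gt0 t00.
by rewrite -(leq_pmul2l K0); apply: leq_trans (large s) (weaken _ _ inv).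
Qed.

Lemma linear_order_solvable : exists t0 K, 0 < K /\
  forall s, exists2 m, order_solvable (2 ^ (t0 + s)) m & 2 ^ (t0 + s) <= K * m.
Proof.
(* Start at order 2^160 with m = 2^50: 5 * 50 + 56 <= 2 * 157, and K = 2^111 gives K m = 2 * 2^160.
   Named exponents keep the powers symbolic. *)
have [a [c [k [aE cE kE]]]] : exists a c k, [/\ a = 157, c = 50 & k = 111].
  by exists 157, 50, 111.
exists (a + 3), (2 ^ k); split; first by rewrite expn_gt0.
apply: (@order_solvable_doubling _ _ (2 ^ c)).
- by lia.
- by rewrite expn_gt0.
- by apply: sparse_order_solvable; lia.
- rewrite mulnAC -expnD (_ : k + c = (a + 3).+1); last by lia.
  by rewrite expnS mulnAC leq_mul2r; apply/orP; right; lia.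
- move=> s; have := quintic_le_pow2 s.
  rewrite (_ : 161 + s = (a + 3 + s).+1); last by lia.
  move: ((a + 3 + s).+1 ^ 5) => x le_x.
  apply: (@leq_trans (2 ^ k * (2 ^ 4 * x))).
    by apply: leq_mul => //; apply: leq_mul.
  rewrite mulnA -expnD; apply: leq_trans (leq_mul (leqnn _) le_x) _.
  by rewrite -expnD leq_exp2l //; lia.
Qed.

(** * Return to cubes *)

Lemma avoidable_of_solvable n (A : cube n) :
  solvable (fun i j k s => s \in A i j k) -> avoidable A.
Proof.
move=> [L [LA L1 L2 L3]]; exists L; split=> //.
have card1 (f : 'I_n -> 'I_n) s : injective f -> #|[set i | f i == s]| = 1.
  move=> inj_f; have [g fK gK] := injF_bij inj_f.
  rewrite -(cards1 (g s)); apply: eq_card => i; rewrite !inE.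
  by rewrite -{1}(gK s) (inj_eq inj_f).
split; [|split] => s x y; [exact: (card1 (L x ^~ y))| |exact: (card1 (L x y))].
exact: (card1 (fun i => L i x y)).
Qed.

Theorem theorem1 :
  exists gamma : rat, (0 < gamma)%R /\
    forall (t m : nat), (30 <= t)%N -> (m%:R <= gamma * (2 ^ t)%:R)%R ->
      forall A : cube (2 ^ t), mmmm_cube m A -> avoidable A.
Proof.
have [t0 [K [K0 lin]]] := linear_order_solvable.
have N0 : 0 < K * 2 ^ t0 by rewrite muln_gt0 K0 expn_gt0.
(* The factor 1/K serves t >= t0; the factor 2^(-t0) forces m = 0 when t < t0. *)
exists ((K * 2 ^ t0)%:R^-1)%R; split; first by rewrite invr_gt0 ltr0n.
move=> t m _; rewrite mulrC ler_pdivlMr ?ltr0n // -natrM ler_nat => le_m A.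
move=> [A4 [A2 [A1 A3]]]; apply: avoidable_of_solvable.
have [le_t|lt_t] := leqP t0 t.
  have [m'] := lin (t - t0); rewrite subnKC // => sol le_m'.
  have le_mm' : m <= m'.
    have := leq_trans le_m le_m'; rewrite mulnCA leq_pmul2l //.
    by apply: leq_trans; rewrite leq_pmulr // expn_gt0.
  apply: (order_solvableW le_mm' sol).
  split=> [j k s|i k s|i j s|i j k]; [exact: A1|exact: A2|exact: A3|].
  by rewrite cardsE.
have m0 : m = 0.
  apply/eqP; rewrite -leqn0 leqNgt; apply/negP => m_gt0.
  have: 2 ^ t0 <= 2 ^ t.
    by apply: leq_trans le_m; rewrite mulnA leq_pmull // muln_gt0 m_gt0.
  by rewrite leq_exp2l // leqNgt lt_t.
(* With m = 0 every cell is empty, and the Cayley cube of a cyclic group avoids [A]. *)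
have [|f bij_f] := @bijective_of_card 'I_(2 ^ t) 'I_(2 ^ t).-1.+1.
  by rewrite !card_ord prednK // expn_gt0.
apply: (solvable_transport bij_f); apply: solvable_pred0 => i j k s.
have := A4 (f i) (f j) (f k); rewrite m0 leqn0 cards_eq0 => /eqP->.
by rewrite inE.
Qed.
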